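(* Let $\beta>0$, $p\in(0,1)$, and let $\psi:\mathbb{R}\to[0,\infty]$ be such that $e^{-\psi}$ is a distribution function on $\mathbb{R}$. Let $X_1,X_2,\ldots$ be i.i.d. G-gamma-MID($\beta$) random variables, i.e. with distribution function $\dfrac{1}{1+\beta\log(1+\psi(x))}$, and let $N$ be a geometric($p$) random variable independent of $X_1,X_2,\ldots$. Then the geometric($p$)-max $\max(X_1,\ldots,X_N)$ is G-gamma-MID($\frac{\beta}{p}$), i.e. it has distribution function $\dfrac{1}{1+\frac{\beta}{p}\log(1+\psi(x))}$.
   Context: All distributions are on $\mathbb{R}$; conventions $e^{-\infty}=0$, $1/\infty=0$, $\log\infty=\infty$. For $\psi:\mathbb{R}\to[0,\infty]$ such that $e^{-\psi}$ is a distribution function and $\beta>0$, the G-gamma-MID($\beta$) (geometric gamma max-infinitely divisible) law has distribution function $\dfrac{1}{1+\beta\log(1+\psi(x))}$. A geometric($p$) law is the geometric law on $\{1,2,\ldots\}$ with mean $1/p$, i.e. $P(N=k)=p(1-p)^{k-1}$. *)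

(* Defs.v *)
From HB Require Import structures.
From mathcomp Require Import all_boot all_order all_algebra finmap.
From mathcomp Require Import all_classical all_reals all_analysis.

Set Implicit Arguments.
Unset Strict Implicit.
Unset Printing Implicit Defensive.

Import Order.TTheory GRing.Theory Num.Theory.
Import numFieldNormedType.Exports.

Local Open Scope classical_set_scope.
Local Open Scope ring_scope.

(* As for [cdf], the values are taken in \bar R. *)
Record is_distribution_function (R : realType) (F : R -> \bar R) : Prop := {
  distribution_function_nondecreasing : {homo F : x y / x <= y >-> (x <= y)%E};
  distribution_function_right_continuous : right_continuous F;
  distribution_function_cvgNy : F x @[x --> -oo] --> 0%E;
  distribution_function_cvgy : F x @[x --> +oo] --> 1%E }.

(* In \bar R one has lne +oo = +oo and +oo^-1 = 0, so the value is 0 where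
   psi is +oo. *)
Definition ggamma_mid_df (R : realType) (beta : R) (psi : R -> \bar R) (x : R) :
    \bar R :=
  ((1 + beta%:E * lne (1 + psi x))^-1)%E.

Section probability_notions.
Context d (T : measurableType d) (R : realType) (P : probability T R).

Definition is_ggamma_mid (beta : R) (psi : R -> \bar R) (X : {RV P >-> R}) :=
  forall x, cdf X x = ggamma_mid_df beta psi x.

(* For 0 < p < 1 these masses sum to 1, so N is almost surely positive. *)
Definition is_geometric (p : R) (N : {RV P >-> nat}) :=
  forall k : nat, (0 < k)%N -> P (N @^-1` [set k]) = (p * (1 - p) ^+ k.-1)%:E.

Definition sigma_RV d' (T' : measurableType d') (X : {RV P >-> T'}) :
    set_system T :=
  preimage_set_system setT X measurable.

Definition sigma_RVs d' (T' : measurableType d') (X : nat -> {RV P >-> T'}) :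
    set_system T :=
  <<s \bigcup_i sigma_RV (X i) >>.

Definition independent_systems (F G : set_system T) :=
  forall A B, F A -> G B -> P (A `&` B) = (P A * P B)%E.

Definition mutually_independent d' (T' : measurableType d')
    (X : nat -> {RV P >-> T'}) :=
  forall (J : {fset nat}) (E : nat -> set T),
    (forall i, i \in J -> sigma_RV (X i) (E i)) ->
    P (\bigcap_(i in [set` J]) E i) = (\prod_(i <- J) P (E i))%E.

(* The sequence X_1, X_2, ... is indexed from 0, so this is
   max(X_1, ..., X_N); the seed X 0 is the first term of the maximum, and is
   the value given on the event N = 0. *)
Definition random_max (N : {RV P >-> nat}) (X : nat -> {RV P >-> R}) (t : T) :
    R :=
  \big[Num.max/X 0%N t]_(i < N t) X i t.

Lemma measurable_random_max (N : {RV P >-> nat}) (X : nat -> {RV P >-> R}) :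
  measurable_fun setT (random_max N X).
Proof.
have mX n : measurable_fun setT (fun t => \big[Num.max/X 0%N t]_(i < n) X i t).
  rewrite [X in measurable_fun _ X](_ : _ = fun t =>
      \big[Num.max/X 0%N t]_(i <- index_iota 0 n) X i t); last first.
    by apply/funext => t; rewrite big_mkord.
  elim: (index_iota 0 n) => [|i r IHr].
    by under eq_fun do rewrite big_nil; exact: measurable_funPT.
  under eq_fun do rewrite big_cons.
  by apply: measurable_realfun.measurable_maxr => //; exact: measurable_funPT.
move=> _ B mB; rewrite setTI.
rewrite [X in measurable X](_ : _ = \bigcup_n (N @^-1` [set n] `&`
    (fun t => \big[Num.max/X 0%N t]_(i < n) X i t) @^-1` B)); last first.
  apply/seteqP; split=> [t Bt|t [n _ [/= <-]]//].
  by exists (N t).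
apply: bigcupT_measurable => n; apply: measurableI.
  exact: measurable_funPTI.
by rewrite -[X in measurable X]setTI; exact: mX.
Qed.

HB.instance Definition _ (N : {RV P >-> nat}) (X : nat -> {RV P >-> R}) :=
  isMeasurableFun.Build _ _ _ _ (random_max N X) (measurable_random_max N X).

End probability_notions.

(* Main.v *)
Require Import Defs.
From mathcomp Require Import all_boot all_order all_algebra.
From mathcomp Require Import all_classical all_reals all_analysis.
From mathcomp Require Import finmap ring.

Import Order.TTheory GRing.Theory Num.Theory.
Import numFieldNormedType.Exports.

Local Open Scope classical_set_scope.
Local Open Scope ring_scope.

(** The proof conditions on [N].  Let [F] be the common distribution function of
    the [X i] and fix [x].  Given [N = n.+1], the maximum is at most [x] exactly
    when [X 0, ..., X n] all are ([random_max_le]), which has probability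
    [F x ^+ n.+1] ([iid_max_cdf]); the event [N = 0] is null
    ([geometric_RV_eq0]).  By independence of [N] from the sequence, summing the
    geometric series gives ([cdf_geometric_max])

      P (max <= x) = \sum_n p * (1 - p) ^+ n * F x ^+ n.+1
                   = p * F x / (1 - (1 - p) * F x).

    Where [F] is positive this reads [1 / G - 1 = (1 / F - 1) / p], [G] being the
    distribution function of the maximum.  With [F = 1 / (1 + beta * L)] and
    [L = log (1 + psi x)], the right-hand side is [beta / p * L], so [G] is the
    G-gamma-MID([beta / p]) distribution function
    ([ggamma_mid_df_geometric]).  Where [F] is 0, so is [G]. *)

Lemma nneseries_geometric (R : realType) (a z : R) : `|z| < 1 ->
  (\sum_(0 <= n <oo) (a * z ^+ n)%:E = (a / (1 - z))%:E)%E.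
Proof.
move=> z1; apply/cvg_lim => //.
rewrite [X in X @ \oo --> _](_ : _ = EFin \o series (geometric a z)).
  by apply: cvg_EFin; [exact: nearW|exact: cvg_geometric_series].
by apply/funext => n /=; rewrite /series/= sumEFin.
Qed.

Lemma probability_sum_levels (R : realType) d (T : measurableType d)
    (P : probability T R) (N : {RV P >-> nat}) (A : set T) : measurable A ->
  P A = (\sum_(0 <= n <oo) P (N @^-1` [set n] `&` A))%E.
Proof.
move=> mA.
rewrite -[in LHS](_ : \bigcup_(n in setT) (N @^-1` [set n] `&` A) = A).
  rewrite measure_bigcup//; first by apply: eq_eseriesl => n; rewrite in_setT.
    by move=> n _; apply: measurableI => //; exact: measurable_funPTI.
  by move=> i j _ _ [t [[/= <- _] [<- _]]].
by apply/seteqP; split=> [t [n _ []]//|t At]; exists (N t).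
Qed.

(** The masses [p * (1 - p) ^+ k.-1], [0 < k], already sum to 1, so the event
    [N = 0] is null. *)
Lemma geometric_RV_eq0 (R : realType) (p : R) d (T : measurableType d)
    (P : probability T R) (N : {RV P >-> nat}) :
  0 < p < 1 -> is_geometric p N -> P (N @^-1` [set 0%N]) = 0%E.
Proof.
move=> /andP[p0 p1] geoN.
have q1 : `|1 - p| < 1 by rewrite ger0_norm ?subr_ge0 1?ltW// gtrBl.
have := probability_sum_levels _ _ _ _ N _ (@measurableT _ T).
under eq_eseriesr do rewrite setIT.
rewrite probability_setT nneseries_recl// -[X in (_ + X)%E]nneseries_addn//.
under eq_eseriesr do rewrite addn1 geoN//.
rewrite nneseries_geometric// opprB addrCA subrr addr0 divff ?gt_eqF//.
have mN0 : measurable (N @^-1` [set 0%N]) by exact: measurable_funPTI.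
rewrite -(fineK (fin_num_measure P _ mN0)) -EFinD => -[].
by rewrite -[LHS]add0r => /addIr <-.
Qed.

(** On [N = n.+1] the seed [X 0] of the maximum is one of its terms, so the
    maximum is at most [x] exactly when each of the [n.+1] terms is. *)
Lemma random_max_le (R : realType) d (T : measurableType d)
    (P : probability T R) (N : {RV P >-> nat}) (X : nat -> {RV P >-> R})
    (n : nat) (x : R) :
  N @^-1` [set n.+1] `&` random_max N X @^-1` `]-oo, x] =
  N @^-1` [set n.+1] `&` \bigcap_(i < n.+1) X i @^-1` `]-oo, x].
Proof.
apply/seteqP; split=> t [Nt]; rewrite /= /random_max Nt.
  rewrite /= in_itv/= => /bigmax_leP[_ Xx]; split=> // i /= ilt.
  by rewrite in_itv/=; exact: (Xx (Ordinal ilt)).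
move=> Xx; split=> //; rewrite in_itv/=.
have {}Xx i : (i < n.+1)%N -> X i t <= x.
  by move=> ilt; have := Xx i ilt; rewrite /= in_itv.
by apply/bigmax_leP; split=> [|i _]; apply: Xx.
Qed.

Lemma iid_max_cdf (R : realType) d (T : measurableType d)
    (P : probability T R) (X : nat -> {RV P >-> R}) (n : nat) (x r : R) :
  mutually_independent X -> (forall i, cdf (X i) x = r%:E) ->
  P (\bigcap_(i < n) X i @^-1` `]-oo, x]) = (r ^+ n)%:E.
Proof.
move=> indX cdfX.
pose J := [fset i in iota 0 n]%fset.
have JE : [set` J] = `I_n.
  by apply/seteqP; split=> i; rewrite /= in_fset/= mem_iota.
rewrite -JE indX; last first.
  by move=> i _; exists `]-oo, x]%classic; [exact: measurable_itv|rewrite setTI].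
rewrite (eq_bigr (fun=> r%:E)) => [|i _]; last exact: cdfX.
rewrite prodEFin (perm_big (iota 0 n)); last first.
  apply: uniq_perm; [exact: fset_uniq|exact: iota_uniq|].
  by move=> i; rewrite in_fset.
by rewrite big_const_seq count_predT size_iota -Monoid.iteropE.
Qed.

(** The distribution function of a geometric maximum of i.i.d. variables, at a
    point [x] where their common distribution function has the value [r]. *)
Lemma cdf_geometric_max (R : realType) (p : R) d (T : measurableType d)
    (P : probability T R) (X : nat -> {RV P >-> R}) (N : {RV P >-> nat})
    (x r : R) :
  0 < p < 1 -> mutually_independent X -> (forall i, cdf (X i) x = r%:E) ->
  is_geometric p N -> independent_systems P (sigma_RV N) (sigma_RVs X) ->
  cdf (random_max N X : {RV P >-> R}) x = (p * r / (1 - (1 - p) * r))%:E.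
Proof.
move=> p01 indX cdfX geoN indNX.
have r0 : 0 <= r by rewrite -lee_fin -(cdfX 0%N) cdf_ge0.
have r1 : r <= 1 by rewrite -lee_fin -(cdfX 0%N) cdf_le1.
have /andP[p0 p1] := p01.
have qr1 : `|(1 - p) * r| < 1.
  have q0 : 0 <= 1 - p by rewrite subr_ge0 ltW.
  rewrite ger0_norm ?mulr_ge0//.
  by rewrite (le_lt_trans (ler_piMr q0 r1))// gtrBl.
have mM : measurable (random_max N X @^-1` `]-oo, x]).
  by rewrite -[X in measurable X]setTI; exact: measurable_random_max.
rewrite -[LHS]/(P (random_max N X @^-1` `]-oo, x])).
rewrite (probability_sum_levels _ _ _ _ N)// nneseries_recl//.
(* The level N = 0, on which the maximum is X 0, contributes nothing. *)
rewrite (@subset_measure0 _ _ _ P _ (N @^-1` [set 0%N]))//; last 3 first.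
- by apply: measurableI => //; exact: measurable_funPTI.
- exact: measurable_funPTI.
- exact: geometric_RV_eq0 p01 geoN.
rewrite add0e -nneseries_addn// -nneseries_geometric//.
apply: eq_eseriesr => n _; rewrite addn1 random_max_le indNX.
- rewrite geoN// (iid_max_cdf _ _ _ _ _ _ _ r)// -EFinM exprMn exprS.
  by congr EFin; ring.
- by exists [set n.+1] => //; rewrite setTI.
(* The finite intersection lies in the sigma-algebra generated by all X i. *)
- set G := \bigcup_i sigma_RV (X i).
  apply: (@bigcap_measurable _ (g_sigma_algebraType G)).
    by exists 0%N.
  move=> i _; apply: sub_sigma_algebra; exists i => //.
  by exists `]-oo, x]%classic; [exact: measurable_itv|rewrite setTI].
Qed.

(** The map [r |-> p * r / (1 - (1 - p) * r)] sends the G-gamma-MID([beta]) value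
    to the G-gamma-MID([beta / p]) value.  Where [psi x] is [+oo] both are 0. *)
Lemma ggamma_mid_df_geometric (R : realType) (beta p : R) (psi : R -> \bar R)
    (x : R) : 0 < beta -> 0 < p < 1 -> (0 <= psi x)%E ->
  exists2 r, ggamma_mid_df beta psi x = r%:E &
    ggamma_mid_df (beta / p) psi x = (p * r / (1 - (1 - p) * r))%:E.
Proof.
move=> b0 /andP[p0 p1] psi0; rewrite /ggamma_mid_df.
have : (0 <= lne (1 + psi x))%E by rewrite lne_ge0 leeDl.
case: (lne _) => [l|_|//].
  rewrite lee_fin => l0.
  have bl0 : 0 < 1 + beta * l by rewrite ltr_pwDl// mulr_ge0// ltW.
  have bpl0 : 0 < 1 + beta / p * l.
    by rewrite ltr_pwDl// mulr_ge0// divr_ge0// ltW.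
  exists (1 + beta * l)^-1; first by rewrite -EFinM -EFinD inver gt_eqF.
  rewrite -EFinM -EFinD inver gt_eqF//; congr EFin.
  have pbl0 : 0 < 1 + beta * l - (1 - p).
    by rewrite subr_gt0 (@lt_le_trans _ _ 1) ?gtrBl// lerDl mulr_ge0// ltW.
  by field; rewrite ?gt_eqF.
exists 0; first by rewrite gt0_muley ?lte_fin// addey// invey.
by rewrite gt0_muley ?lte_fin ?divr_gt0// addey// invey mulr0 mul0r.
Qed.

Theorem theorem2p7 (R : realType) (beta p : R) (psi : R -> \bar R)
    (d : measure_display) (T : measurableType d) (P : probability T R)
    (X : nat -> {RV P >-> R}) (N : {RV P >-> nat}) :
  0 < beta -> 0 < p < 1 ->
  (forall x, (0 <= psi x)%E) ->
  is_distribution_function (fun x => expeR (- psi x)%E) ->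
  mutually_independent X ->
  (forall i, is_ggamma_mid beta psi (X i)) ->
  is_geometric p N ->
  independent_systems P (sigma_RV N) (sigma_RVs X) ->
  is_ggamma_mid (P := P) (beta / p) psi (random_max N X).
Proof.
move=> beta0 p01 psi0 _ indX cdfX geoN indNX x.
have [r dfX ->] := ggamma_mid_df_geometric _ _ _ _ x beta0 p01 (psi0 x).
by apply: cdf_geometric_max => // i; rewrite cdfX.
Qed.
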